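(* Let $A=(a_{ij})\in M_n(\mathbb{H})$, let $\gamma\in[0,1]$, and let $p,q\in(1,\infty)$ with $\frac1p+\frac1q=1$. For every right eigenvalue $\mu$ of $A$ there exists a nonzero quaternion $\beta$ such that $\beta^{-1}\mu\beta$ (which is also a right eigenvalue of $A$) is contained in the union of the $n$ generalized balls $$B_i(A):=\left\{z\in\mathbb{H}: |z-a_{ii}|\le (n-1)^{\frac{1-\gamma}{q}}\,r_i(A)^{\gamma}\,\bigl(n_i^{(p)}(A)\bigr)^{1-\gamma}\right\},\qquad 1\le i\le n;$$ that is, $\{z^{-1}\mu z: 0\neq z\in\mathbb{H}\}\cap\bigcup_{i=1}^n B_i(A)\ne\emptyset$.
   Context: $\mathbb{H}$ is the skew field of real quaternions with its usual modulus $|\cdot|$, and $M_n(\mathbb{H})$ is the set of $n\times n$ quaternionic matrices. A quaternion $\mu$ is a right eigenvalue of $A$ if $Ax=x\mu$ for some nonzero column vector $x\in\mathbb{H}^n$. $r_i(A):=\sum_{j\ne i}|a_{ij}|$ and $n_i^{(p)}(A):=\bigl(\sum_{j\neq i}|a_{ij}|^p\bigr)^{1/p}$. Convention: $0^0=1$. *)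

(* Defs.v *)
From HB Require Import structures.
From mathcomp Require Import all_boot all_order all_algebra.
From mathcomp Require Import all_classical all_reals exp.
From mathcomp Require Import ring.

Set Implicit Arguments.
Unset Strict Implicit.
Unset Printing Implicit Defensive.

Import Order.TTheory GRing.Theory Num.Theory.

Local Open Scope classical_set_scope.
Local Open Scope ring_scope.

(* [Quat a b c d] is a + b i + c j + d k, with i^2 = j^2 = k^2 = ijk = -1. *)
Record quaternion (R : realType) :=
  Quat { qre : R; qi : R; qj : R; qk : R }.

Definition quat_to_tuple (R : realType) (x : quaternion R) : R * R * R * R :=
  (qre x, qi x, qj x, qk x).

Definition quat_of_tuple (R : realType) (t : R * R * R * R) : quaternion R :=
  let: (a, b, c, d) := t in Quat a b c d.

Lemma quat_to_tupleK (R : realType) :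
  cancel (@quat_to_tuple R) (@quat_of_tuple R).
Proof. by case. Qed.

HB.instance Definition _ (R : realType) :=
  Choice.copy (quaternion R) (can_type (@quat_to_tupleK R)).

Definition quat_add (R : realType) (x y : quaternion R) : quaternion R :=
  Quat (qre x + qre y) (qi x + qi y) (qj x + qj y) (qk x + qk y).

Definition quat_opp (R : realType) (x : quaternion R) : quaternion R :=
  Quat (- qre x) (- qi x) (- qj x) (- qk x).

Lemma quat_addA (R : realType) : associative (@quat_add R).
Proof. by move=> x y z; rewrite /quat_add /= !addrA. Qed.

Lemma quat_addC (R : realType) : commutative (@quat_add R).
Proof. by move=> x y; congr Quat; rewrite addrC. Qed.

Lemma quat_add0 (R : realType) : left_id (Quat 0 0 0 0) (@quat_add R).
Proof. by case=> *; rewrite /quat_add /= !add0r. Qed.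

Lemma quat_addN (R : realType) :
  left_inverse (Quat 0 0 0 0) (@quat_opp R) (@quat_add R).
Proof. by case=> *; rewrite /quat_add /= !addNr. Qed.

HB.instance Definition _ (R : realType) :=
  GRing.isZmodule.Build (quaternion R)
    (@quat_addA R) (@quat_addC R) (@quat_add0 R) (@quat_addN R).

Definition quat_mul (R : realType) (x y : quaternion R) : quaternion R :=
  Quat (qre x * qre y - qi x * qi y - qj x * qj y - qk x * qk y)
       (qre x * qi y + qi x * qre y + qj x * qk y - qk x * qj y)
       (qre x * qj y - qi x * qk y + qj x * qre y + qk x * qi y)
       (qre x * qk y + qi x * qj y - qj x * qi y + qk x * qre y).

Lemma quat_mulA (R : realType) : associative (@quat_mul R).
Proof. by move=> x y z; congr Quat => /=; ring. Qed.

Lemma quat_mul1l (R : realType) : left_id (Quat 1 0 0 0) (@quat_mul R).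
Proof. by case=> *; congr Quat => /=; ring. Qed.

Lemma quat_mul1r (R : realType) : right_id (Quat 1 0 0 0) (@quat_mul R).
Proof. by case=> *; congr Quat => /=; ring. Qed.

Lemma quat_mulDl (R : realType) : left_distributive (@quat_mul R) +%R.
Proof. by move=> x y z; congr Quat => /=; ring. Qed.

Lemma quat_mulDr (R : realType) : right_distributive (@quat_mul R) +%R.
Proof. by move=> x y z; congr Quat => /=; ring. Qed.

Lemma quat_oner_neq0 (R : realType) : (Quat 1 0 0 0 : quaternion R) != 0.
Proof. by apply/eqP => -[] /eqP; rewrite oner_eq0. Qed.

HB.instance Definition _ (R : realType) :=
  GRing.Zmodule_isNzRing.Build (quaternion R)
    (@quat_mulA R) (@quat_mul1l R) (@quat_mul1r R)
    (@quat_mulDl R) (@quat_mulDr R) (@quat_oner_neq0 R).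

Definition quat_sqrnorm (R : realType) (x : quaternion R) : R :=
  qre x ^+ 2 + qi x ^+ 2 + qj x ^+ 2 + qk x ^+ 2.

Definition quat_modulus (R : realType) (x : quaternion R) : R :=
  Num.sqrt (quat_sqrnorm x).

Lemma quat_sqrnorm_eq0 (R : realType) (x : quaternion R) :
  (quat_sqrnorm x == 0) = (x == 0).
Proof.
apply/eqP/eqP => [|->]; last by rewrite /quat_sqrnorm /= expr0n /= !addr0.
case: x => a b c d; rewrite /quat_sqrnorm /= => /eqP.
rewrite !paddr_eq0 ?addr_ge0 ?sqr_ge0// !sqrf_eq0.
by move=> /andP[/andP[/andP[/eqP-> /eqP->] /eqP->] /eqP->].
Qed.

(* The conjugate divided by the squared modulus; it sends 0 to 0. *)
Definition quat_inv (R : realType) (x : quaternion R) : quaternion R :=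
  Quat (qre x / quat_sqrnorm x) (- qi x / quat_sqrnorm x)
       (- qj x / quat_sqrnorm x) (- qk x / quat_sqrnorm x).

Lemma quat_mulV (R : realType) :
  {in [pred x : quaternion R | x != 0],
    left_inverse 1 (@quat_inv R) (@quat_mul R)}.
Proof.
move=> [a b c d]; rewrite inE -quat_sqrnorm_eq0 /quat_sqrnorm /= => N0.
by congr Quat => /=; rewrite /quat_sqrnorm /=; field.
Qed.

Lemma quat_mulrV (R : realType) :
  {in [pred x : quaternion R | x != 0],
    right_inverse 1 (@quat_inv R) (@quat_mul R)}.
Proof.
move=> [a b c d]; rewrite inE -quat_sqrnorm_eq0 /quat_sqrnorm /= => N0.
by congr Quat => /=; rewrite /quat_sqrnorm /=; field.
Qed.

Lemma quat_unitP (R : realType) (x y : quaternion R) :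
  y * x = 1 /\ x * y = 1 -> x \in [pred x : quaternion R | x != 0].
Proof.
case=> yx _; rewrite inE; apply/eqP => x0; move: yx.
by rewrite x0 mulr0 => /esym/eqP; rewrite oner_eq0.
Qed.

Lemma quat_inv_out (R : realType) :
  {in [predC [pred x : quaternion R | x != 0]], @quat_inv R =1 id}.
Proof.
move=> x; rewrite !inE negbK => /eqP ->.
by congr Quat; rewrite /= ?oppr0 mul0r.
Qed.

HB.instance Definition _ (R : realType) :=
  GRing.NzRing_hasMulInverse.Build (quaternion R)
    (@quat_mulV R) (@quat_mulrV R) (@quat_unitP R) (@quat_inv_out R).

Lemma quat_unitE (R : realType) (x : quaternion R) :
  (x \is a GRing.unit) = (x != 0).
Proof. by []. Qed.

Definition right_eigenvalue (R : realType) (n : nat)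
    (A : 'M[quaternion R]_n) (mu : quaternion R) : Prop :=
  exists2 x : 'cV[quaternion R]_n, x != 0 & A *m x = \col_i (x i 0 * mu).

(* r_i(A) *)
Definition row_radius (R : realType) (n : nat)
    (A : 'M[quaternion R]_n) (i : 'I_n) : R :=
  \sum_(j < n | j != i) quat_modulus (A i j).

(* n_i^(p)(A) *)
Definition row_pradius (R : realType) (n : nat) (p : R)
    (A : 'M[quaternion R]_n) (i : 'I_n) : R :=
  (\sum_(j < n | j != i) quat_modulus (A i j) `^ p) `^ p^-1.

(* [powR] satisfies [0 `^ 0 = 1] and [0 `^ x = 0] for [x != 0]. *)
Definition gen_ball (R : realType) (n : nat) (gamma p q : R)
    (A : 'M[quaternion R]_n) (i : 'I_n) : set (quaternion R) :=
  [set z | quat_modulus (z - A i i) <=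
    n.-1%:R `^ ((1 - gamma) / q) * row_radius A i `^ gamma *
    row_pradius p A i `^ (1 - gamma)].

Definition similarity_class (R : realType) (mu : quaternion R) :
    set (quaternion R) :=
  [set z^-1 * mu * z | z in [set z | z != 0]].

(* Main.v *)
Require Import Defs.
From mathcomp Require Import all_boot all_order all_algebra.
From mathcomp Require Import all_classical all_reals exp.
From mathcomp Require Import ring.

(** Gershgorin's argument works over the quaternions because the modulus is
    multiplicative and subadditive.  If [A x = x mu] and [x_i] is an entry of
    largest modulus, row [i] reads
    [x_i mu = a_ii x_i + \sum_(j != i) a_ij x_j]; multiplying by [x_i^-1] on
    the right isolates the conjugate [x_i mu x_i^-1] (not [mu] itself), whose
    distance to [a_ii] is then at most [r_i(A)].  Thus [beta = x_i^-1]
    ([eigenvalue_conj_gershgorin]), whatever [gamma], [p] and [q] are.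

    It remains to compare radii in the same row [i].  Hoelder's inequality
    against the constant family 1 ([hoelder_sum]) gives
    [r_i <= (n - 1)^(1/q) n_i^(p)], and a geometric mean of [r_i] with an
    upper bound of [r_i] is again an upper bound ([le_powR_mean]). *)

Set Implicit Arguments.
Unset Strict Implicit.
Unset Printing Implicit Defensive.

Import Order.TTheory GRing.Theory Num.Theory.

Local Open Scope classical_set_scope.
Local Open Scope ring_scope.

Section Modulus.
Variable R : realType.
Implicit Types x y : quaternion R.

Definition quat_conj x : quaternion R := Quat (qre x) (- qi x) (- qj x) (- qk x).

Lemma quat_sqrnorm_ge0 x : 0 <= quat_sqrnorm x.
Proof. by rewrite /quat_sqrnorm !addr_ge0 ?sqr_ge0. Qed.

Lemma quat_modulus_ge0 x : 0 <= quat_modulus x.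
Proof. exact: sqrtr_ge0. Qed.

Lemma sqr_quat_modulus x : quat_modulus x ^+ 2 = quat_sqrnorm x.
Proof. by rewrite sqr_sqrtr ?quat_sqrnorm_ge0. Qed.

Lemma quat_modulus0 : quat_modulus (0 : quaternion R) = 0.
Proof.
by apply/eqP; rewrite -sqrf_eq0 sqr_quat_modulus quat_sqrnorm_eq0.
Qed.

Lemma quat_modulus_gt0 x : (0 < quat_modulus x) = (x != 0).
Proof.
by rewrite sqrtr_gt0 lt_def quat_sqrnorm_ge0 andbT quat_sqrnorm_eq0.
Qed.

Lemma quat_modulus_conj x : quat_modulus (quat_conj x) = quat_modulus x.
Proof. by congr Num.sqrt; rewrite /quat_sqrnorm /= !sqrrN. Qed.

(** For the squared moduli this is Euler's four-square identity. *)
Lemma quat_modulusM x y : quat_modulus (x * y) = quat_modulus x * quat_modulus y.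
Proof.
rewrite /quat_modulus -sqrtrM ?quat_sqrnorm_ge0//; congr Num.sqrt.
by rewrite /quat_sqrnorm /=; ring.
Qed.

Lemma qre_le_modulus x : qre x <= quat_modulus x.
Proof.
apply: le_trans (ler_norm _) _; rewrite -sqrtr_sqr ler_wsqrtr//.
by rewrite /quat_sqrnorm -!addrA lerDl !addr_ge0 ?sqr_ge0.
Qed.

(** The Euclidean scalar product of [x] and [y] is the real part of
    [x * quat_conj y], so multiplicativity of the modulus yields the
    Cauchy-Schwarz inequality needed here. *)
Lemma ler_quat_modulusD x y :
  quat_modulus (x + y) <= quat_modulus x + quat_modulus y.
Proof.
rewrite -ler_sqr ?nnegrE ?addr_ge0 ?quat_modulus_ge0//.
rewrite sqrrD !sqr_quat_modulus.
have -> : quat_sqrnorm (x + y) =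
    quat_sqrnorm x + qre (x * quat_conj y) *+ 2 + quat_sqrnorm y.
  by rewrite /quat_sqrnorm /=; ring.
rewrite lerD2r lerD2l lerMn2r orFb.
by rewrite -[quat_modulus y]quat_modulus_conj -quat_modulusM qre_le_modulus.
Qed.

Lemma ler_quat_modulus_sum (I : finType) (P : pred I) (F : I -> quaternion R) :
  quat_modulus (\sum_(i | P i) F i) <= \sum_(i | P i) quat_modulus (F i).
Proof.
elim/big_ind2: _ => [|x u y v xu yv|//]; first by rewrite quat_modulus0.
by apply: le_trans (ler_quat_modulusD _ _) _; rewrite lerD.
Qed.

End Modulus.

Section RightEigenvalues.
Variables (R : realType) (n : nat) (A : 'M[quaternion R]_n).

Lemma right_eigenvalue_conj (mu beta : quaternion R) :
  beta != 0 -> right_eigenvalue A mu ->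
  right_eigenvalue A (beta^-1 * mu * beta).
Proof.
move=> beta0 [x x0 Ax]; have betaU : beta \is a GRing.unit by rewrite quat_unitE.
exists (\col_i (x i 0 * beta)).
  apply: contra x0 => /eqP/colP xb0; apply/eqP/colP => i.
  by move: (xb0 i); rewrite !mxE => /(congr1 ( *%R^~ beta^-1)); rewrite mulrK ?mul0r.
apply/colP => i; rewrite !mxE !mulrA mulrK//.
have /colP/(_ i) := Ax; rewrite !mxE => <-; rewrite mulr_suml.
by apply: eq_bigr => j _; rewrite mxE mulrA.
Qed.

Lemma eigenvalue_conj_gershgorin (mu : quaternion R) :
  right_eigenvalue A mu ->
  exists2 beta, beta != 0 &
    exists i, quat_modulus (beta^-1 * mu * beta - A i i) <= row_radius A i.
Proof.
move=> [x x0 Ax].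
have [k xk0] : exists k, x k 0 != 0.
  apply/existsP; apply: contraNT x0 => /existsPn x0; apply/eqP/colP => k.
  by rewrite mxE; apply/eqP; move: (x0 k); rewrite negbK.
have [i _ xmax] := @arg_maxP _ _ _ k xpredT (fun i => quat_modulus (x i 0)) isT.
have xi_gt0 : 0 < quat_modulus (x i 0).
  by apply: lt_le_trans (xmax k isT); rewrite quat_modulus_gt0.
have xi0 : x i 0 != 0 by rewrite -quat_modulus_gt0.
exists (x i 0)^-1; first by rewrite -quat_unitE unitrV quat_unitE.
exists i; rewrite invrK -(ler_pM2r xi_gt0) -quat_modulusM.
have -> : (x i 0 * mu * (x i 0)^-1 - A i i) * x i 0 =
    \sum_(j < n | j != i) A i j * x j 0.
  have /colP/(_ i) := Ax; rewrite !mxE (bigD1 i)//= => xmu.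
  by rewrite mulrBl mulrVK ?quat_unitE// -xmu [LHS]addrC addKr.
apply: le_trans (ler_quat_modulus_sum _ _) _; rewrite /row_radius mulr_suml.
apply: ler_sum => j _; rewrite quat_modulusM.
by rewrite ler_wpM2l ?quat_modulus_ge0//; exact: xmax.
Qed.

End RightEigenvalues.

Section Radii.
Variable R : realType.

Lemma powR_sum_eq0 (I : finType) (P : pred I) (p : R) (a : I -> R) :
  \sum_(i | P i) a i `^ p = 0 -> forall i, P i -> a i = 0.
Proof.
move=> S0 i Pi; apply: (@powR_eq0_eq0 _ _ p).
by apply: (psumr_eq0P _ S0) => // j _; rewrite powR_ge0.
Qed.

Lemma powR_divr (x y p : R) :
  0 <= x -> 0 < y -> (x / y) `^ p = x `^ p / y `^ p.
Proof.
move=> x0 y0; apply/(canRL (mulfK _)); first by rewrite gt_eqF ?powR_gt0.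
by rewrite -powRM ?divfK ?divr_ge0 ?gt_eqF// ltW.
Qed.

(** After normalising both families to have norm 1, this is the sum of the
    termwise Young inequalities. *)
Lemma hoelder_sum (I : finType) (P : pred I) (p q : R) (a b : I -> R) :
  0 < p -> 0 < q -> p^-1 + q^-1 = 1 ->
  (forall i, 0 <= a i) -> (forall i, 0 <= b i) ->
  \sum_(i | P i) a i * b i <=
  (\sum_(i | P i) a i `^ p) `^ p^-1 * (\sum_(i | P i) b i `^ q) `^ q^-1.
Proof.
move=> p0 q0 pq a0 b0.
set S := \sum_(i | P i) a i `^ p; set T := \sum_(i | P i) b i `^ q.
set s := S `^ p^-1; set t := T `^ q^-1.
have st_ge0 : 0 <= s * t by rewrite mulr_ge0 ?powR_ge0.
have S0 : 0 <= S by apply: sumr_ge0 => i _; exact: powR_ge0.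
have T0 : 0 <= T by apply: sumr_ge0 => i _; exact: powR_ge0.
have [/powR_sum_eq0 a_eq0|Sn0] := eqVneq S 0.
  by rewrite big1// => i Pi; rewrite a_eq0 ?mul0r.
have [/powR_sum_eq0 b_eq0|Tn0] := eqVneq T 0.
  by rewrite big1// => i Pi; rewrite b_eq0 ?mulr0.
have Sgt0 : 0 < S by rewrite lt_def Sn0.
have Tgt0 : 0 < T by rewrite lt_def Tn0.
have s0 : 0 < s by rewrite powR_gt0.
have t0 : 0 < t by rewrite powR_gt0.
have spE : s `^ p = S by rewrite -powRrM mulVf ?gt_eqF// powRr1.
have tqE : t `^ q = T by rewrite -powRrM mulVf ?gt_eqF// powRr1.
clearbody s t; rewrite -[leRHS]mul1r -ler_pdivrMr ?mulr_gt0// mulr_suml.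
have young i : P i -> a i * b i / (s * t) <=
    p^-1 / S * a i `^ p + q^-1 / T * b i `^ q.
  move=> _; have -> : a i * b i / (s * t) = (a i / s) * (b i / t).
    by field; rewrite !gt_eqF.
  have as0 : 0 <= a i / s by rewrite divr_ge0// ltW.
  have bt0 : 0 <= b i / t by rewrite divr_ge0// ltW.
  apply: le_trans (conjugate_powR as0 bt0 p0 q0 pq) _.
  rewrite !powR_divr// spE tqE.
  by rewrite le_eqVlt; apply/orP; left; apply/eqP; ring.
apply: le_trans (ler_sum _ young) _.
by rewrite big_split/= -!mulr_sumr -/S -/T !divfK// pq.
Qed.

(** The exponents sum to 1, which is nonzero, so the splitting
    [r = r^gamma * r^(1 - gamma)] holds even at [r = 0]; the second factor
    is monotone in its base. *)
Lemma le_powR_mean (gamma r s : R) :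
  0 <= gamma <= 1 -> 0 <= r <= s -> r <= r `^ gamma * s `^ (1 - gamma).
Proof.
move=> /andP[g0 g1] /andP[r0 rs].
rewrite -[leLHS]powRr1// -[in leLHS](subrKC gamma 1) powRD.
  by rewrite ler_wpM2l ?powR_ge0// ge0_ler_powR ?nnegrE ?subr_ge0// (le_trans r0).
by rewrite subrKC oner_eq0.
Qed.

Lemma row_radius_le_pradius (n : nat) (A : 'M[quaternion R]_n) (p q : R)
    (i : 'I_n) :
  0 < p -> 0 < q -> p^-1 + q^-1 = 1 ->
  row_radius A i <= n.-1%:R `^ q^-1 * row_pradius p A i.
Proof.
move=> p0 q0 pq; have := @hoelder_sum _ (fun j => j != i) p q
  (fun j => quat_modulus (A i j)) (fun=> 1) p0 q0 pq
  (fun j => quat_modulus_ge0 _) (fun=> ler01).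
under eq_bigr do rewrite mulr1.
by rewrite powR1 sumr_const cardC1 card_ord mulrC.
Qed.

End Radii.

Theorem theorem3p16 (R : realType) (n : nat) (A : 'M[quaternion R]_n)
    (gamma p q : R) (gamma_ge0 : 0 <= gamma) (gamma_le1 : gamma <= 1)
    (p_gt1 : 1 < p) (q_gt1 : 1 < q) (pq : p^-1 + q^-1 = 1)
    (mu : quaternion R) (mu_eig : right_eigenvalue A mu) :
  (exists beta : quaternion R,
    [/\ beta != 0,
        right_eigenvalue A (beta^-1 * mu * beta)
      & (\bigcup_(i in [set: 'I_n]) gen_ball gamma p q A i)
          (beta^-1 * mu * beta)]) /\
  similarity_class mu `&` \bigcup_(i in [set: 'I_n]) gen_ball gamma p q A i
    !=set0.
Proof.
have [beta beta0 [i disc_i]] := eigenvalue_conj_gershgorin mu_eig.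
have p0 : 0 < p by apply: lt_trans p_gt1.
have q0 : 0 < q by apply: lt_trans q_gt1.
have in_ball : (\bigcup_(i in [set: 'I_n]) gen_ball gamma p q A i)
    (beta^-1 * mu * beta).
  exists i => //; apply: le_trans disc_i _.
  have r0 : 0 <= row_radius A i.
    by apply: sumr_ge0 => j _; exact: quat_modulus_ge0.
  have /(le_powR_mean (gamma := gamma)) : 0 <= row_radius A i <=
      n.-1%:R `^ q^-1 * row_pradius p A i.
    by rewrite r0 row_radius_le_pradius.
  rewrite gamma_ge0 gamma_le1 => /(_ isT).
  rewrite powRM ?powR_ge0// -powRrM [q^-1 * _]mulrC.
  by rewrite mulrCA mulrA.
split; first by exists beta; split => //; exact: right_eigenvalue_conj.
by exists (beta^-1 * mu * beta); split => //; exists beta.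
Qed.
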